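(* Let $t>0$, $M>0$, $n\geq1$, and let $\mathfrak{a}_n$ and $\mathfrak{a}_n^{\dagger}$ be the differential operators $$\mathfrak{a}_n=\begin{vmatrix}A_2(t;n)&C_1(x,t;n)\\ B_2(x,t;n)&D_1(x,t;n)\end{vmatrix}+\Delta(x,t;n)\frac{d}{dx},\qquad \mathfrak{a}_n^{\dagger}=\begin{vmatrix}A_1(x,t;n)&C_2(x,t;n)\\ B_1(t;n)&D_2(x,t;n)\end{vmatrix}-\Delta(x,t;n)\frac{d}{dx}.$$ Then $$\mathfrak{a}_n[Q_n^t(x)]=\begin{vmatrix}A_1(x,t;n)&C_1(x,t;n)\\ B_1(t;n)&D_1(x,t;n)\end{vmatrix}Q_{n-1}^t(x),\qquad \mathfrak{a}_n^{\dagger}[Q_{n-1}^t(x)]=\begin{vmatrix}A_2(t;n)&C_2(x,t;n)\\ B_2(x,t;n)&D_2(x,t;n)\end{vmatrix}Q_n^t(x).$$ That is, $\mathfrak{a}_n$ and $\mathfrak{a}_n^{\dagger}$ are respectively lowering and raising operators associated with $\{Q_n^t\}_{n\geq0}$.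
   Context: For polynomials with real coefficients put $\langle p,q\rangle_t=\int_{\mathbb{R}}p(x)q(x)e^{-x^4+2tx^2}dx$ and $\|p\|_t^2=\langle p,p\rangle_t$. $\{F_n^t\}_{n\geq0}$ is the sequence of monic polynomials ($\deg F_n^t=n$) orthogonal with respect to $\langle\cdot,\cdot\rangle_t$; it satisfies $xF_n^t(x)=F_{n+1}^t(x)+a_n^2(t)F_{n-1}^t(x)$ with $F_{-1}^t=0$, $F_0^t=1$, $a_0^2(t)=0$, and $a_n^2(t)=\|F_n^t\|_t^2/\|F_{n-1}^t\|_t^2>0$ for $n\ge1$. The kernel is $K_n(x,y;t)=\sum_{k=0}^n F_k^t(x)F_k^t(y)/\|F_k^t\|_t^2$ (with $K_{-1}=0$). $\{Q_n^t\}_{n\geq0}$ is the sequence of monic polynomials ($\deg Q_n^t=n$) orthogonal with respect to $\langle p,q\rangle=\langle p,q\rangle_t+Mp(0)q(0)$. Put $b_n^t=\dfrac{1+MK_n(0,0;t)}{1+MK_{n-1}(0,0;t)}$ for $n\ge 0$. For $n\geq1$ define $A_1(x,t;n)=x$, $\ B_1(t;n)=a_n^2(t)(b_n^t-1)$, $\ A_2(t;n)=1-b_{n-1}^t$, $\ B_2(x,t;n)=x\,b_{n-1}^t$, $C_1(x,t;n)=-4a_n^2(t)\left[b_n^tx^2+(b_n^t-1)\left(a_{n-1}^2(t)+a_n^2(t)-t\right)\right]$, $D_1(x,t;n)=4a_n^2(t)\,x\left(a_{n+1}^2(t)+b_n^t\left[x^2-t+a_n^2(t)\right]\right)-\frac1x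 a_n^2(t)(b_n^t-1)$, $C_2(x,t;n)=(b_{n-1}^t-1)\left(4xa_n^2(t)+\frac1x\right)-4x\,b_{n-1}^t\left[x^2-t+a_{n-1}^2(t)+a_n^2(t)\right]$, $D_2(x,t;n)=4a_n^2(t)(1-b_{n-1}^t)\left[x^2-t+a_n^2(t)+a_{n+1}^2(t)\right]+4x^2b_{n-1}^t\left[x^2-t+a_n^2(t)\right]$, $\Delta(x,t;n)=x^2b_{n-1}^t+a_n^2(t)(b_n^t-1)(b_{n-1}^t-1)$. Vertical bars denote $2\times2$ determinants; identities are between rational functions of $x$. *)

(* Defs.v *)
From HB Require Import structures.
From mathcomp Require Import all_boot all_order all_algebra.
From mathcomp Require Import all_classical all_reals all_analysis.
Set Implicit Arguments.
Unset Strict Implicit.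
Unset Printing Implicit Defensive.
Import Order.TTheory GRing.Theory Num.Theory.
Import numFieldNormedType.Exports.
Local Open Scope ring_scope.

Section OrthogonalPolynomials.
Context {R : realType}.
Implicit Types (t M : R) (p q : {poly R}) (F : nat -> {poly R}).

Definition ip t p q : R :=
  \int[@lebesgue_measure R]_(x in setT)
    (p.[x] * q.[x] * expR (- x ^+ 4 + 2 * t * x ^+ 2)).

Definition normsq t p : R := ip t p p.

Definition ipM t M p q : R := ip t p q + M * p.[0] * q.[0].

(* This determines F uniquely when form is an inner product. *)
Definition monic_orthogonal (form : {poly R} -> {poly R} -> R) F : Prop :=
  [/\ forall n, F n \is monic,
      forall n, size (F n) = n.+1 &
      forall m n, m != n -> form (F m) (F n) = 0].

(* asq t F n is a_n^2(t), with a_0^2(t) = 0. *)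
Definition asq t F (n : nat) : R :=
  if n is m.+1 then normsq t (F n) / normsq t (F m) else 0.

(* The index is shifted by one: kernel t F m is K_{m-1}, so that K_{-1} = 0
   is kernel t F 0. *)
Definition kernel t F (m : nat) (x y : R) : R :=
  \sum_(0 <= k < m) (F k).[x] * (F k).[y] / normsq t (F k).

(* b_n = (1 + M K_n(0,0)) / (1 + M K_{n-1}(0,0)) *)
Definition bcoef t M F (n : nat) : R :=
  (1 + M * kernel t F n.+1 0 0) / (1 + M * kernel t F n 0 0).

End OrthogonalPolynomials.

Section LadderOperators.
Context {R : realType}.
Notation ratfun := {fraction {poly R}}.
Implicit Types (t M : R) (F : nat -> {poly R}).

Definition cst (c : R) : ratfun := tofrac c%:P.
Definition X : ratfun := tofrac 'X.

Definition A1 : ratfun := X.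

Definition B1 t M F n : ratfun := cst (asq t F n * (bcoef t M F n - 1)).

Definition A2 t M F n : ratfun := cst (1 - bcoef t M F n.-1).

Definition B2 t M F n : ratfun := X * cst (bcoef t M F n.-1).

Definition C1 t M F n : ratfun :=
  let a k := cst (asq t F k) in let b k := cst (bcoef t M F k) in
  - 4 * a n * (b n * X ^+ 2 + (b n - 1) * (a n.-1 + a n - cst t)).

Definition D1 t M F n : ratfun :=
  let a k := cst (asq t F k) in let b k := cst (bcoef t M F k) in
  4 * a n * X * (a n.+1 + b n * (X ^+ 2 - cst t + a n))
  - X^-1 * a n * (b n - 1).

Definition C2 t M F n : ratfun :=
  let a k := cst (asq t F k) in let b k := cst (bcoef t M F k) in
  (b n.-1 - 1) * (4 * X * a n + X^-1)
  - 4 * X * b n.-1 * (X ^+ 2 - cst t + a n.-1 + a n).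

Definition D2 t M F n : ratfun :=
  let a k := cst (asq t F k) in let b k := cst (bcoef t M F k) in
  4 * a n * (1 - b n.-1) * (X ^+ 2 - cst t + a n + a n.+1)
  + 4 * X ^+ 2 * b n.-1 * (X ^+ 2 - cst t + a n).

Definition Delta t M F n : ratfun :=
  let a k := cst (asq t F k) in let b k := cst (bcoef t M F k) in
  X ^+ 2 * b n.-1 + a n * (b n - 1) * (b n.-1 - 1).

(* | a b |
   | c d | *)
Definition det2 (a b c d : ratfun) : ratfun :=
  \det (\matrix_(i < 2, j < 2)
    if i == 0 then (if j == 0 then a else b) else (if j == 0 then c else d)).

(* The differential operator u + v d/dx, acting on polynomials. *)
Definition diffop (u v : ratfun) (p : {poly R}) : ratfun :=
  u * tofrac p + v * tofrac p^`().

Definition lowering t M F n : {poly R} -> ratfun :=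
  diffop (det2 (A2 t M F n) (C1 t M F n)
               (B2 t M F n) (D1 t M F n))
         (Delta t M F n).

Definition raising t M F n : {poly R} -> ratfun :=
  diffop (det2 A1           (C2 t M F n)
               (B1 t M F n) (D2 t M F n))
         (- Delta t M F n).

End LadderOperators.

(* Main.v *)
Require Import Defs.
From mathcomp Require Import all_boot all_order all_algebra.
From mathcomp Require Import all_classical all_reals all_analysis.
From mathcomp Require Import measurable_realfun.
From mathcomp Require Import ring lra.
Set Implicit Arguments.
Unset Strict Implicit.
Unset Printing Implicit Defensive.
Import Order.TTheory GRing.Theory Num.Theory.
Import numFieldNormedType.Exports.
Local Open Scope ring_scope.

(** Write [a n], [b n] for the coefficients [asq t F n], [bcoef t M F n].
    The two ladder relations are Cramer's rule.  Both [x Q_n] and [x Q_{n-1}]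
    are combinations of [F_n] and [F_{n-1}], with coefficient matrix
    [A1 B1; A2 B2] of determinant [Delta], and so are [x Q_n'] and
    [x Q_{n-1}'], with rows [C1 D1] and [C2 D2]; eliminating [F_n] and
    [F_{n-1}] between three of these four relations gives each statement
    ([eliminate_basis]).

    The expansions rest on three facts.
    - The weight is even, so [F_n] has the parity of [n] ([parity]) and the
      three-term recurrence has no diagonal term ([recurrence]).
    - The logarithmic derivative of the weight is the polynomial
      [-4x^3 + 4tx]; integrating by parts ([ip_deriv]) turns [F_n'] into a
      combination of [F_n] and [F_{n-1}] ([structure_relation]).
    - [Q_n] is [F_n] minus a multiple of the reproducing kernel at 0
      ([Q_kernel]).  By the Christoffel-Darboux formula [x] times the kernel
      is a combination of [F_n] and [F_{n-1}]; as one of [F_n(0)],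
      [F_{n-1}(0)] vanishes, only [F_{n-1}] survives ([XQ]).

    The identities [parity], [recurrence], [structure_relation] and [Q_kernel]
    are proved in the same way: the difference of the two sides has size at
    most some [m] and is orthogonal to every polynomial of size at most [m],
    hence is zero ([ip_nondegenerate]).

    The analytic input is that the moment functional is finite, linear,
    positive definite and even, and that it annihilates [(p w)' / w] for the
    weight [w].  It is all derived from the domination of [p w] by a multiple
    of a Gaussian ([wpoly_le_gauss]). *)

(** * The moment functional of the weight exp(-x^4 + 2tx^2) *)

Section QuarticWeight.
Context {R : realType}.
Variable t : R.
Notation mu := (@lebesgue_measure R).
Implicit Types p q : {poly R}.

Definition weight (x : R) : R := expR (- x ^+ 4 + 2 * t * x ^+ 2).
Definition wpoly p (x : R) : R := p.[x] * weight x.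
Definition wint p : R := \int[mu]_(x in setT) wpoly p x.

(** An exponential of a multiple of [x^2] is a convenient majorant because it
    is stable under multiplication by [x]: [|x| <= 1 + x^2 <= exp(x^2)]. *)
Lemma horner_le_expR p :
  exists C k : R, forall x, `|p.[x]| <= C * expR (k * x ^+ 2).
Proof.
suff [C [k [C0 k0 H]]] : exists C k : R, [/\ 0 <= C, 0 <= k &
    forall x, `|p.[x]| <= C * expR (k * x ^+ 2)] by exists C, k.
elim/poly_ind: p => [|p c [C [k [C0 k0 H]]]].
  by exists 0, 0; split=> // x; rewrite horner0 normr0 mul0r.
exists (C + `|c|), (k + 1); split; rewrite ?addr_ge0// => x.
rewrite hornerMXaddC (le_trans (ler_normD _ _))// mulrDl lerD//.
- rewrite normrM mulrDl mul1r expRD mulrA ler_pM//.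
  apply: le_trans (expR_ge1Dx _).
  have := normr_ge0 x; rewrite -(real_normK (num_real x)); nra.
- rewrite ler_peMr// -expR0 ler_expR mulr_ge0 ?sqr_ge0 ?addr_ge0//.
Qed.

(** The quartic term absorbs any quadratic one, and completing the square
    leaves a spare [- x^2]. *)
Lemma wpoly_le_gauss p : exists C : R, forall x, `|wpoly p x| <= C * gauss_fun x.
Proof.
have [C [k H]] := horner_le_expR p.
(* -x^4 + (2t + k) x^2 = -x^2 + s^2 - (x^2 - s)^2 *)
pose s := (k + 2 * t + 1) / 2.
exists (C * expR (s ^+ 2)) => x.
have C0 : 0 <= C.
  have := H 0; rewrite expr0n/= mulr0 expR0 mulr1; exact: le_trans.
rewrite normrM (ger0_norm (expR_ge0 _)) /weight.
apply: (le_trans (ler_wpM2r _ (H x))); first exact: expR_ge0.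
rewrite -!mulrA ler_wpM2l// /gauss_fun -!expRD ler_expR.
rewrite -subr_ge0 [leRHS](_ : _ = (x ^+ 2 - s) ^+ 2) ?sqr_ge0//.
by rewrite /s; field.
Qed.

Lemma continuous_wpoly p : continuous (wpoly p).
Proof.
move=> x; apply: cvgM; first exact: continuous_horner.
have -> : weight = expR \o horner (- 'X^4 + (2 * t) *: 'X^2).
  by apply/funext => y; rewrite /weight /= !hornerE.
apply: continuous_comp; [exact: continuous_horner|exact: continuous_expR].
Qed.

Lemma integrable_wpoly p : mu.-integrable setT (EFin \o wpoly p).
Proof.
have [C H] := wpoly_le_gauss p.
have mw : measurable_fun setT (wpoly p).
  by apply: continuous_measurable_fun; exact: continuous_wpoly.
apply: (@le_integrable _ _ _ mu setT measurableT _
  (fun x => C%:E * (EFin \o gauss_fun) x)%E).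
- exact/measurable_EFinP.
- move=> x _ /=; rewrite lee_fin (le_trans (H x))// ler_norm//.
- exact: integrableZl integrableT_gauss.
Qed.

Lemma wintD p q : wint (p + q) = wint p + wint q.
Proof.
rewrite /wint -RintegralD//; try exact: integrable_wpoly.
by apply: eq_Rintegral => x _; rewrite /wpoly hornerD mulrDl.
Qed.

Lemma wintZ c p : wint (c *: p) = c * wint p.
Proof.
rewrite /wint -RintegralZl//; last exact: integrable_wpoly.
by apply: eq_Rintegral => x _; rewrite /wpoly hornerZ mulrA.
Qed.

Local Open Scope classical_set_scope.

(** This reduces statements on the whole line to segments, where the
    fundamental theorem of calculus and the change of variable [x -> -x] apply
    to functions of any sign. *)
Lemma cvg_wint p :
  (\int[mu]_(x in `[(- n%:R)%R, n%:R%R]) (wpoly p x)%:E)%E @[n --> \oo]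
     --> (wint p)%:E.
Proof.
have ip := integrable_wpoly p.
have -> : (wint p)%:E = (\int[mu]_(x in setT) (wpoly p x)%:E)%E.
  by rewrite /wint /Rintegral fineK//; exact: integrable_fin_num ip.
under eq_fun do rewrite integral_mkcond.
have [] := @dominated_convergence _ _ _ mu setT measurableT
  (fun n : nat => (EFin \o wpoly p) \_ `[(- n%:R)%R, n%:R%R])
  (EFin \o wpoly p) (abse \o (EFin \o wpoly p)).
- move=> n; apply/(measurable_restrictT _ _).1 => //.
  by apply: measurable_funTS; case/integrableP : ip.
- by case/integrableP : ip.
- apply: aeW => x _; apply: cvg_near_cst.
  near=> n; rewrite /restrict ifT// inE/= in_itv/= -ler_norml.
  near: n; exact: nbhs_infty_ger.
- exact: integrable_abse.
- apply: aeW => x n _; rewrite /restrict; case: ifP => //= _.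
  by rewrite normr0 lee_fin.
- by [].
Unshelve. all: by end_near. Qed.

Lemma wint_comp_opp p : wint (p \Po - 'X) = wint p.
Proof.
have hp := @cvg_wint p; have hq := @cvg_wint (p \Po - 'X).
suff E : (fun n : nat => \int[mu]_(x in `[(- n%:R)%R, n%:R%R]) (wpoly p x)%:E)%E =
         (fun n : nat => \int[mu]_(x in `[(- n%:R)%R, n%:R%R]) (wpoly (p \Po - 'X) x)%:E)%E.
  apply: EFin_inj; rewrite E in hp; exact: (cvg_unique _ hq hp).
apply/funext => n.
have := @integration_by_substitution_oppr R (wpoly p) (- n%:R) n%:R.
rewrite opprK => -> //.
- apply: eq_integral => x _ /=; rewrite /wpoly /weight horner_comp !hornerE /=.
  by congr (_ * expR _)%:E; ring.
- by rewrite ge0_cp ?ler0n.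
- by apply: continuous_subspaceT => x; exact: continuous_wpoly.
Qed.

(** The logarithmic derivative of the weight is [-4x^3 + 4tx], so
    differentiation maps polynomials times the weight to such functions. *)
Lemma is_derive_wpoly p x :
  is_derive x (1 : R) (wpoly p)
    (wpoly (p^`() - (4 *: 'X^3 - (4 * t) *: 'X) * p) x).
Proof.
pose e : {poly R} := - 'X^4 + (2 * t) *: 'X^2.
have we y : weight y = expR e.[y] by rewrite /weight /e !hornerE.
have -> : wpoly p = (horner p * (expR \o horner e))%R.
  by apply/funext => y; rewrite /wpoly we fctE.
apply: trigger_derive.
rewrite /wpoly we /= /e !(derivD, derivN, derivZ, derivXn) !hornerE /=.
have key (E P P' y : R) : P * (E * (- (y ^+ 3 + y ^+ 3 + y ^+ 3 + y ^+ 3) +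
    2 * t * (y + y))) + E * P' = (P' - (4 * y * y * y - 4 * t * y) * P) * E.
  by ring.
exact: key.
Qed.

(** The integrand is the derivative of [p] times the weight, which vanishes at
    both infinities by the Gaussian bound. *)
Lemma wint_by_parts p :
  wint (p^`() - (4 *: 'X^3 - (4 * t) *: 'X) * p) = 0.
Proof.
set q := (X in wint X = _).
have [C pC] := wpoly_le_gauss p.
have gcvg : (C * gauss_fun n%:R) @[n --> \oo] --> (0 : R).
  rewrite -(mulr0 C); apply: cvgM; first exact: cvg_cst.
  exact: cvg_comp cvgr_idn cvg_gauss_fun.
have cvg0 (s : R) : `|s| = 1 -> (wpoly p (s * n%:R)) @[n --> \oo] --> (0 : R).
  move=> s1; apply/norm_cvg0P; apply: squeeze_cvgr (cvg_cst 0) gcvg.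
  near=> n; rewrite normr_ge0/= (le_trans (pC _))// /gauss_fun exprMn.
  by rewrite -[s ^+ 2]real_normK ?num_real// s1 expr1n mul1r.
(* Segments start at n = 1, since the fundamental theorem needs a < b. *)
have E : (fun n : nat => \int[mu]_(x in `[(- n.+1%:R)%R, n.+1%:R%R]) (wpoly q x)%:E)%E =
   (fun n => (wpoly p (1 * n.+1%:R) - wpoly p (- 1 * n.+1%:R))%:E)%E.
  apply/funext => n; rewrite mul1r mulN1r EFinB; apply: continuous_FTC2.
  - by rewrite gtrN.
  - by apply: continuous_subspaceT => x; exact: continuous_wpoly.
  - split.
    + by move=> x _; have [] := is_derive_wpoly p x.
    + exact/cvg_at_right_filter/continuous_wpoly.
    + exact/cvg_at_left_filter/continuous_wpoly.
  - move=> x _; rewrite derive1E; have [] := is_derive_wpoly p x.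
    by move=> _ ->.
have hq : (wpoly p (1 * n.+1%:R) - wpoly p (- 1 * n.+1%:R))%:E @[n --> \oo]
    --> (wint q)%:E.
  by have := @cvg_wint q; rewrite -cvg_shiftS -E.
suff h0 : (wpoly p (1 * n.+1%:R) - wpoly p (- 1 * n.+1%:R))%:E @[n --> \oo]
    --> (0 : R)%:E.
  by apply: EFin_inj; exact: (cvg_unique _ hq h0).
apply: cvg_EFin; first exact: nearW.
rewrite -[X in _ --> X]subr0; apply: cvgB.
  by move/(_ 1 (normr1 _)): cvg0; rewrite -cvg_shiftS.
have /cvg0 : `|-1 : R| = 1 by rewrite normrN1.
by rewrite -cvg_shiftS.
Unshelve. all: by end_near. Qed.

Lemma countable_root p : p != 0 -> countable [set x | root p x].
Proof.
move=> p0; apply: finite_set_countable; apply: contrapT.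
move=> /(infinite_set_fset (size p)) [rs rsp].
apply/negP; rewrite -ltnNge; apply: max_poly_roots => //.
- by apply/allP => x /rsp.
- exact: finmap.fset_uniq.
Qed.

(** A square times the weight has zero integral only if it vanishes almost
    everywhere; a nonzero polynomial vanishes on a null set, and the unit
    segment is not null. *)
Lemma wint_sqr_eq0 p : wint (p * p) = 0 -> p = 0.
Proof.
move=> I0; apply/eqP/negPn/negP => p0.
have ip := integrable_wpoly (p * p).
have : (\int[mu]_(x in setT) `|(wpoly (p * p) x)%:E| = 0)%E.
  rewrite -[RHS]/(0%:E) -I0 /wint /Rintegral fineK; last first.
    exact: integrable_fin_num ip.
  apply: eq_integral => x _ /=; congr EFin; rewrite ger0_norm// /wpoly.
  by rewrite mulr_ge0 ?expR_ge0// hornerM -expr2 sqr_ge0.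
move=> /(ae_eq_integral_abs mu measurableT (measurable_int mu ip)) ae0.
have : mu.-negligible `[0 : R, 1].
  have nr : mu.-negligible [set x | root p x].
    apply/negligibleP; last exact/countable_lebesgue_measure0/countable_root.
    apply: countable_measurable; last exact: countable_root.
    exact: measurable_set1.
  apply: negligibleS (negligibleU ae0 nr) => x _.
  have [px0|px0] := boolP (root p x); [by right|left] => /(_ I).
  rewrite /wpoly/= => -[] /eqP; rewrite mulf_eq0 hornerM mulf_eq0 orbb.
  by rewrite [_ == 0 as X in X || _](negbTE px0) gt_eqF// expR_gt0.
move/negligibleP => /(_ (measurable_itv _)) /=.
rewrite lebesgue_measure_itv/= lte_fin ltr01 oppr0 adde0 => -[] /eqP.
by rewrite oner_eq0.
Qed.
End QuarticWeight.

(** * Leading coefficients, parity and orthogonality to lower degrees *)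

Lemma size_sub_monic (R : nzRingType) (p q : {poly R}) n :
  p \is monic -> size p = n.+1 -> (size q <= n.+1)%N ->
  (size (q - q`_n *: p)%R <= n)%N.
Proof.
move=> p_monic sp sq; apply/leq_sizeP => j; rewrite leq_eqVlt coefB coefZ.
case/predU1P => [<-|nj].
  by have := monicP p_monic; rewrite lead_coefE sp /= => ->; rewrite mulr1 subrr.
rewrite (nth_default 0 (leq_trans sq nj)).
by rewrite (nth_default 0 (_ : size p <= j)%N) ?sp// mulr0 subrr.
Qed.

Lemma coef_comp_oppX (R : comNzRingType) (p : {poly R}) i :
  (p \Po - 'X)`_i = (-1) ^+ i * p`_i.
Proof.
elim/poly_ind: p i => [|p c IH] i; first by rewrite comp_poly0 !coef0 mulr0.
rewrite comp_polyD comp_polyM comp_polyX comp_polyC mulrN.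
rewrite !(coefD, coefN, coefMX, coefC); case: i => [|i] /=.
  by rewrite oppr0 !add0r mul1r.
by rewrite !addr0 IH exprS mulN1r mulNr.
Qed.

Lemma size_comp_oppX (R : idomainType) (p : {poly R}) :
  size (p \Po - 'X) = size p.
Proof. by rewrite size_comp_poly2// size_polyN size_polyX. Qed.

Lemma size_mulX_le (R : idomainType) (p : {poly R}) n :
  (size p <= n)%N -> (size ('X * p)%R <= n.+1)%N.
Proof.
by move=> sp; rewrite (leq_trans (size_polyMleq _ _))// size_polyX.
Qed.

(** The polynomials [F 0], ..., [F k] span those of size at most [k.+1]; the
    proof removes leading terms one at a time.  Stated for an arbitrary form,
    as it applies both to the weight alone and to the weight with a point mass
    at 0. *)
Lemma orthogonal_lower (R : realType) (form : {poly R} -> {poly R} -> R) F :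
  (forall p c q r, form p (c *: q + r) = c * form p q + form p r) ->
  monic_orthogonal form F ->
  forall n (q : {poly R}), (size q <= n)%N -> form (F n) q = 0.
Proof.
move=> lin [F_monic sF F_orth] n q.
have form0 p : form p 0 = 0.
  by have := lin p (-1) 0 0; rewrite scaler0 addr0 mulN1r addNr.
suff H k : (k <= n)%N -> forall q : {poly R}, (size q <= k)%N -> form (F n) q = 0 by exact: H.
elim: k => [|k IH] kn {}q sq.
  by move: sq; rewrite leqn0 size_poly_eq0 => /eqP ->.
rewrite -(subrKC (q`_k *: F k) q) lin F_orth ?gtn_eqF// mulr0 add0r.
by apply: IH; [exact: ltnW|exact: size_sub_monic].
Qed.

(** * Elimination in the field of rational functions *)

Lemma det2E (R : realType) (c d e f : {fraction {poly R}}) :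
  det2 c d e f = c * f - d * e.
Proof.
rewrite /det2 (expand_det_row _ 0) !big_ord_recl big_ord0 addr0 /cofactor.
by rewrite !det_mx11 !mxE /= expr0 expr1 mul1r mulN1r mulrN.
Qed.

Local Notation cst := Defs.cst.

Section ConstantFractions.
Context {R : realType}.
Implicit Types c d : R.

Lemma cstD c d : cst (c + d) = cst c + cst d.
Proof. by rewrite /cst polyCD tofracD. Qed.

Lemma cstN c : cst (- c) = - cst c.
Proof. by rewrite /cst polyCN tofracN. Qed.

Lemma cstM c d : cst (c * d) = cst c * cst d.
Proof. by rewrite /cst polyCM tofracM. Qed.

Lemma cst_nat n : cst (n%:R : R) = n%:R.
Proof. by rewrite /cst polyC_natr rmorph_nat. Qed.

End ConstantFractions.

(** Cramer's rule: the factor [x] common to the three relations is cancelled,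
    and no division by the determinant takes place. *)
Lemma eliminate_basis (K : fieldType) (x f g p q p' A1 B1 A2 B2 C D : K) :
  x != 0 -> x * p = A1 * f + B1 * g -> x * q = A2 * f + B2 * g ->
  x * p' = C * f + D * g ->
  (A2 * D - C * B2) * p + (A1 * B2 - B1 * A2) * p' = (A1 * D - C * B1) * q.
Proof.
move=> x_neq0 xp xq xp'; apply: (mulfI x_neq0).
by rewrite mulrDr !(mulrCA x) xp xq xp'; ring.
Qed.

(** Here [f], [g] stand for [F_n], [F_{n-1}], and [df], [dg] for the values of
    their derivatives given by the structure relations.  The left-hand sides
    are [x^2] times the derivatives of [Q_n] and [Q_{n-1}], computed from
    [(x Q)' = Q + x Q']. *)
Section LadderCoefficients.
Variables (K : fieldType) (x t a0 a1 a2 b f g : K).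
Hypothesis x_neq0 : x != 0.

Let df := 4 * a1 * ((x ^+ 2 - t + a1 + a2) * g - x * f).
Let dg := 4 * (x * (x ^+ 2 - t + a1) * g - (x ^+ 2 - t + a0 + a1) * f).

Lemma deriv_coefficients :
  x * (f + x * df + a1 * (b - 1) * dg) - (x * f + a1 * (b - 1) * g) =
  x * (- 4 * a1 * (b * x ^+ 2 + (b - 1) * (a0 + a1 - t)) * f +
       (4 * a1 * x * (a2 + b * (x ^+ 2 - t + a1)) - x^-1 * a1 * (b - 1)) * g).
Proof. by rewrite /df /dg; field. Qed.

Lemma deriv_coefficients_lower :
  x * ((1 - b) * df + b * (g + x * dg)) - ((1 - b) * f + x * b * g) =
  x * (((b - 1) * (4 * x * a1 + x^-1) - 4 * x * b * (x ^+ 2 - t + a0 + a1)) * f +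
       (4 * a1 * (1 - b) * (x ^+ 2 - t + a1 + a2)
        + 4 * x ^+ 2 * b * (x ^+ 2 - t + a1)) * g).
Proof. by rewrite /df /dg; field. Qed.

End LadderCoefficients.

(** * Recurrence and structure relations for the weight *)

Section FreudPolynomials.
Context {R : realType} (t : R).
Implicit Types p q r : {poly R}.

Lemma ipE p q : ip t p q = wint t (p * q).
Proof. by apply: eq_Rintegral => x _; rewrite /wpoly hornerM. Qed.

Lemma ipC p q : ip t p q = ip t q p.
Proof. by rewrite !ipE mulrC. Qed.

Lemma ipMl p q r : ip t (p * q) r = ip t q (p * r).
Proof. by rewrite !ipE; congr wint; ring. Qed.

Lemma ip_linear p c q r : ip t p (c *: q + r) = c * ip t p q + ip t p r.
Proof. by rewrite !ipE mulrDr wintD -scalerAr wintZ. Qed.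

Lemma ipDl p q r : ip t (p + q) r = ip t p r + ip t q r.
Proof. by rewrite !ipE mulrDl wintD. Qed.

Lemma ipCl (c : R) p q : ip t (c%:P * p) q = c * ip t p q.
Proof. by rewrite !ipE -mulrA mul_polyC wintZ. Qed.

Lemma ipNl p q : ip t (- p) q = - ip t p q.
Proof. by rewrite -mulN1r -[-1]/(- 1%:P) -polyCN ipCl mulN1r. Qed.

Lemma ipBl p q r : ip t (p - q) r = ip t p r - ip t q r.
Proof. by rewrite ipDl ipNl. Qed.

Lemma ip_deriv p q :
  ip t p^`() q = ip t p ((4 *: 'X^3 - (4 * t) *: 'X) * q) - ip t p q^`().
Proof.
rewrite !ipE; have := wint_by_parts t (p * q); rewrite derivM.
set V := _ - _ *: 'X.
have -> : p^`() * q + p * q^`() - V * (p * q) =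
  (-1) *: (p * (V * q)) + (p^`() * q + p * q^`()) by rewrite scaleN1r; ring.
by rewrite !wintD wintZ => by_parts; apply: subr0_eq; rewrite -by_parts; ring.
Qed.

Lemma ip_self_gt0 p : p != 0 -> 0 < ip t p p.
Proof.
move=> p0; rewrite lt_neqAle eq_sym; apply/andP; split.
  by apply: contra_neq p0 => pp0; apply: (@wint_sqr_eq0 _ t); rewrite -ipE.
apply: Rintegral_ge0 => x _.
by rewrite mulr_ge0 ?expR_ge0// -expr2 sqr_ge0.
Qed.

(** Such a [p] is orthogonal to itself. *)
Lemma ip_nondegenerate n p : (size p <= n)%N ->
  (forall q, (size q <= n)%N -> ip t p q = 0) -> p = 0.
Proof.
move=> sp p_orth; apply: contrapT => /eqP /ip_self_gt0.
by rewrite p_orth ?ltxx.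
Qed.

Variable F : nat -> {poly R}.
Hypothesis F_orth : monic_orthogonal (ip t) F.

Let a n := asq t F n.
Let h n := normsq t (F n).
Let F_monic n : F n \is monic. Proof. by case: F_orth. Qed.
Let F_size n : size (F n) = n.+1. Proof. by case: F_orth. Qed.
Let F_neq0 n : F n != 0. Proof. by rewrite -size_poly_eq0 F_size. Qed.

Let h_gt0 n : 0 < h n. Proof. exact: ip_self_gt0. Qed.
Let h_neq0 n : h n != 0. Proof. exact: lt0r_neq0. Qed.
Let aE n : a n.+1 = h n.+1 / h n. Proof. by []. Qed.
Let ah n : a n.+1 * h n = h n.+1.
Proof. by rewrite /a /= -/(h n) -/(h n.+1) divfK. Qed.
Let F_lead n : (F n)`_n = 1.
Proof. by have /monicP := F_monic n; rewrite lead_coefE F_size. Qed.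

Lemma ip_lower n q : (size q <= n)%N -> ip t (F n) q = 0.
Proof. exact: (orthogonal_lower ip_linear F_orth). Qed.

Lemma ip_monic n q : (size q <= n.+1)%N -> ip t (F n) q = q`_n * h n.
Proof.
move=> sq; rewrite -[in LHS](subrKC (q`_n *: F n) q) ip_linear.
by rewrite [X in _ + X]ip_lower ?addr0// size_sub_monic.
Qed.

(** [F n] composed with [- 'X] has leading coefficient [(-1)^n] and, the weight
    being even, satisfies the same orthogonality relations. *)
Lemma parity n : F n \Po - 'X = (-1) ^+ n *: F n.
Proof.
have top : (F n \Po - 'X)`_n = (-1) ^+ n by rewrite coef_comp_oppX F_lead mulr1.
apply/eqP; rewrite -subr_eq0; apply/eqP/(@ip_nondegenerate n) => [|q sq].
  by rewrite -top size_sub_monic// size_comp_oppX F_size.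
rewrite -mul_polyC ipBl ipCl ip_lower// mulr0 subr0 ipE -wint_comp_opp.
rewrite comp_polyM -comp_polyA raddfN /= comp_polyX opprK comp_polyXr -ipE.
by rewrite ip_lower// size_comp_oppX.
Qed.

Lemma subleading_eq0 n : (F n.+1)`_n = 0.
Proof.
have := coef_comp_oppX (F n.+1) n; rewrite parity coefZ exprS => /eqP.
rewrite -subr_eq0 -mulrBl mulN1r -opprD -mulr2n mulf_eq0 oppr_eq0 mulrn_eq0/=.
by rewrite signr_eq0 => /eqP.
Qed.

(** One of two consecutive indices is odd, and odd polynomials vanish at 0. *)
Lemma value0_eq0 n : (F n).[0] * (F n.+1).[0] = 0.
Proof.
have p0 k : (F k).[0] = (-1) ^+ k * (F k).[0].
  by rewrite -hornerZ -parity horner_comp !hornerE oppr0.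
have := p0 n; have := p0 n.+1; rewrite exprS.
have neg (x : R) : x = - x -> x = 0.
  by move/eqP; rewrite -subr_eq0 opprK -mulr2n mulrn_eq0 => /eqP.
rewrite -signr_odd; case: odd; rewrite /= ?expr0 ?expr1 ?mulN1r ?opprK ?mul1r.
  by move=> _ /neg ->; rewrite mul0r.
by move=> /neg -> _; rewrite mulr0.
Qed.

(** The difference, of degree at most [n] as leading terms cancel, has no
    coefficient of degree [n] by parity, and
    multiplication by ['X] is self-adjoint, so only its product with
    [F n.-1] remains to be computed. *)
Lemma recurrence n : 'X * F n = F n.+1 + (a n)%:P * F n.-1.
Proof.
apply/eqP; rewrite -subr_eq0 opprD addrA; apply/eqP.
set r := _ - _.
have sr : (size r <= n)%N.
  apply/leq_sizeP => j nj; rewrite /r !(coefB, coefXM, coefCM).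
  case: j nj => [|j] /=.
    by rewrite leqn0 => /eqP -> /=; rewrite subleading_eq0 /a /= mul0r !subr0.
  rewrite leq_eqVlt => /predU1P[->|nj].
    by rewrite !subleading_eq0 (nth_default 0 (_ : size (F j) <= _)%N) ?F_size// mulr0 !subr0.
  have F_pred : (F n.-1)`_j.+1 = 0.
    by rewrite nth_default// F_size; case: (n) nj => // k /leqW.
  move: nj; rewrite F_pred mulr0 subr0 ltnS leq_eqVlt => /predU1P[<-|nj].
    by rewrite !F_lead subrr.
  by rewrite !nth_default ?F_size ?subrr.
case: n @r sr => [|n] r sr; first by apply/eqP; rewrite -size_poly_eq0 -leqn0.
apply: ip_nondegenerate sr _ => q sq.
rewrite /r !ipBl ipMl ipCl ip_monic ?size_mulX_le// ip_lower ?(leqW sq)//.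
by rewrite ip_monic// coefXM/= subr0 mulrCA ah subrr.
Qed.

(** Let [q] have size at most [n.+1].  Integration by parts turns the product
    of the derivative of [F n.+1] with [q] into that of
    [4 'X^3 F n.+1 - 4 t 'X F n.+1] with [q], as [F n.+1] is orthogonal to the
    derivative of [q].  Moving one factor ['X] to [q] and expanding
    ['X^2 F n.+1] by the recurrence leaves [F n.+3], which is orthogonal to
    ['X q], then [F n.+1], which only sees the coefficient of degree [n] of
    [q], and a multiple of [F n.-1], whose product with ['X q] cancels against
    the same term of the right-hand side without being evaluated. *)
Lemma structure_relation n :
  (F n.+1)^`() = (4 * a n.+1)%:P *
    (('X^2 - t%:P + (a n.+1)%:P + (a n.+2)%:P) * F n - 'X * F n.+1).
Proof.
pose c := a n.+1 + a n.+2 - t.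
have rec0 := recurrence n; have rec1 := recurrence n.+1; have rec2 := recurrence n.+2.
(* In this form no term has degree larger than n. *)
have -> : ('X^2 - t%:P + (a n.+1)%:P + (a n.+2)%:P) * F n - 'X * F n.+1 =
    c%:P * F n + (a n)%:P * ('X * F n.-1).
  rewrite /c polyCB polyCD.
  have -> : F n.+1 = 'X * F n - (a n)%:P * F n.-1 by rewrite rec0 addrK.
  by ring.
apply/eqP; rewrite -subr_eq0; apply/eqP/(@ip_nondegenerate n.+1) => [|q sq].
  rewrite (leq_trans (size_polyD _ _))// size_polyN geq_max; apply/andP; split.
    by rewrite -ltnS -(F_size n.+1) lt_size_deriv.
  rewrite !mul_polyC (leq_trans (size_scale_leq _ _))//.
  rewrite (leq_trans (size_polyD _ _))// geq_max (leq_trans (size_scale_leq _ _)) ?F_size//=.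
  case: (n) => [|k]; first by rewrite /a /= scale0r size_poly0.
  by rewrite (leq_trans (size_scale_leq _ _))// size_mulX_le ?F_size.
have sXq : (size ('X * q)%R <= n.+2)%N by exact: size_mulX_le.
have XXF : 'X * ('X * F n.+1) =
    F n.+3 + (a n.+2 + a n.+1)%:P * F n.+1 + (a n.+1 * a n)%:P * F n.-1.
  by rewrite rec1 mulrDr rec2 /= mulrCA rec0 polyCD polyCM; ring.
have ip_drop : ip t (F n.+1) ((4 *: 'X^3 - (4 * t) *: 'X) * q) =
    4 * ip t ('X * ('X * F n.+1)) ('X * q) - 4 * t * ip t (F n.+1) ('X * q).
  rewrite -!ipCl -ipBl !ipE -!mul_polyC !polyCM; congr wint; ring.
have sq' : (size q^`() <= n.+1)%N.
  have [->|q0] := eqVneq q 0; first by rewrite deriv0 size_poly0.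
  exact: ltnW (leq_trans (lt_size_deriv q0) sq).
rewrite ipBl ip_deriv ip_drop XXF !(ipDl, ipCl) (ip_lower (leqW sXq)).
rewrite (ip_monic sXq) (ip_lower sq') (ip_monic sq) !ipMl -ah /c.
by rewrite (_ : ('X * q)`_n.+1 = q`_n) ?coefXM//; ring.
Qed.

(** The structure relation one step down, with [F n.-1] eliminated by the
    recurrence.  It holds for [n = 0] too, because [F 1 = 'X]. *)
Lemma structure_relation_lower n :
  (F n)^`() = 4%:P * ('X * ('X^2 - t%:P + (a n.+1)%:P) * F n
    - ('X^2 - t%:P + (a n)%:P + (a n.+1)%:P) * F n.+1).
Proof.
case: n => [|n].
  have F0 : F 0 = 1.
    by rewrite (size1_polyC (_ : size (F 0%N) <= 1)%N) ?F_size// F_lead.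
  have := recurrence 0; rewrite /a /= polyC0 mul0r addr0 => <-.
  by rewrite F0 derivC; ring.
rewrite structure_relation.
have aF : (a n.+1)%:P * F n = 'X * F n.+1 - F n.+2.
  by rewrite recurrence /= addrC addKr.
rewrite polyCM -mulrA mulrBr [_ * (_ * F n)]mulrCA aF.
ring.
Qed.

(** * The reproducing kernel at 0 and the point mass *)

(** [K m] is [K_{m-1}(x, 0)] as a polynomial in [x], with the shifted index of
    [kernel]. *)
Let K m : {poly R} := \sum_(0 <= k < m) ((F k).[0] / h k)%:P * F k.

Lemma horner_K m x : (K m).[x] = Defs.kernel t F m x 0.
Proof.
rewrite /K /kernel horner_sum; apply: eq_bigr => k _.
by rewrite hornerCM mulrC mulrA.
Qed.

Lemma KS m : K m.+1 = K m + ((F m).[0] / h m)%:P * F m.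
Proof. by rewrite /K big_nat_recr. Qed.

Lemma size_K m : (size (K m) <= m)%N.
Proof.
elim: m => [|m IH]; first by rewrite /K big_nil size_poly0.
rewrite KS (leq_trans (size_polyD _ _))// geq_max (leqW IH) mul_polyC.
by rewrite (leq_trans (size_scale_leq _ _))// F_size.
Qed.

(** The reproducing property, at the point 0. *)
Lemma ip_K m q : (size q <= m)%N -> ip t (K m) q = q.[0].
Proof.
elim: m q => [|m IH] q sq.
  move: sq; rewrite leqn0 size_poly_eq0 => /eqP ->.
  by rewrite horner0 ipE mulr0 -(scale0r 0) wintZ mul0r.
have Kq : ip t (K m) q = q.[0] - q`_m * (F m).[0].
  rewrite -[in LHS](subrKC (q`_m *: F m) q) ip_linear ipC (ip_lower (size_K m)).
  by rewrite (IH _ (size_sub_monic (F_monic m) (F_size m) sq)) !hornerE.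
by rewrite KS ipDl ipCl (ip_monic sq) Kq; field.
Qed.

(** Christoffel-Darboux with one argument equal to 0, by induction on the
    recurrence, which at 0 reads [F_{m+2}(0) = - a_{m+1} F_m(0)]. *)
Lemma christoffel_darboux m :
  'X * K m.+1 = ((F m).[0] / h m)%:P * F m.+1 - ((F m.+1).[0] / h m)%:P * F m.
Proof.
elim: m => [|m IH].
  have F1 : F 1 = 'X * F 0 by rewrite recurrence mul0r addr0.
  rewrite KS {1}/K big_nil add0r F1 hornerM hornerX !mul0r subr0.
  by rewrite mulrCA.
have F_at0 : (F m.+2).[0] = - (a m.+1 * (F m).[0]).
  apply/eqP; rewrite -addr_eq0 -hornerCM -hornerD -[X in _ + _ * X]/(F m.+1.-1).
  by rewrite -recurrence hornerM hornerX mul0r.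
rewrite KS mulrDr IH mulrCA recurrence -[m.+1.-1]/m F_at0.
have f1 : (F m.+1).[0] / h m = (F m.+1).[0] / h m.+1 * a m.+1.
  by rewrite aE; field; rewrite !h_neq0.
have f0 : - (a m.+1 * (F m).[0]) / h m.+1 = - ((F m).[0] / h m).
  by rewrite aE; field; rewrite !h_neq0.
by rewrite f1 f0 [in LHS]polyCM polyCN; ring.
Qed.

Lemma K0_ge0 m : 0 <= (K m).[0].
Proof.
rewrite horner_sum sumr_ge0// => k _; rewrite hornerCM mulrAC -expr2.
by rewrite divr_ge0 ?sqr_ge0 ?ltW.
Qed.

Section PointMass.
Variables (M : R) (Q : nat -> {poly R}).
Hypothesis M_gt0 : 0 < M.
Hypothesis Q_orth : monic_orthogonal (ipM t M) Q.

Let b n := bcoef t M F n.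
Let u n := 1 + M * (K n).[0].
Let u_gt0 n : 0 < u n.
Proof. by rewrite /u ltr_pwDl// mulr_ge0 ?K0_ge0// ltW. Qed.

Let bE n : b n = u n.+1 / u n.
Proof. by rewrite /b /bcoef -!horner_K. Qed.

Lemma ipM_linear p c q r : ipM t M p (c *: q + r) = c * ipM t M p q + ipM t M p r.
Proof. by rewrite /ipM ip_linear hornerD hornerZ; ring. Qed.

(** Against [q] of size at most [n], the inner product of [Q n] for the weight
    alone is [- M Q_n(0) q(0)], which the kernel reproduces. *)
Lemma Q_kernel n : Q n = F n - (M * (Q n).[0])%:P * K n.
Proof.
have [Q_monic Q_size _] := Q_orth.
apply/eqP; rewrite -subr_eq0 opprB addrCA addrC; apply/eqP.
apply: (@ip_nondegenerate n) => [|q sq].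
  rewrite (leq_trans (size_polyD _ _))// geq_max mul_polyC.
  rewrite (leq_trans (size_scale_leq _ _)) ?size_K//=.
  have Q_lead : (Q n)`_n = 1.
    by have /monicP := Q_monic n; rewrite lead_coefE Q_size.
  by rewrite -[F n]scale1r -Q_lead size_sub_monic// Q_size.
rewrite ipDl ipBl ipCl ip_K// ip_lower// subr0.
exact: (orthogonal_lower ipM_linear Q_orth).
Qed.

Lemma Q_at0 n : (Q n).[0] = (F n).[0] / u n.
Proof.
apply: (canRL (mulfK (lt0r_neq0 (u_gt0 n)))).
have := congr1 (horner^~ 0) (Q_kernel n).
rewrite hornerD hornerN hornerCM => Q0.
by rewrite /u mulrDr mulr1 {1}Q0; ring.
Qed.

(** The first row [A1 B1] of the expansion matrix: Christoffel-Darboux applied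
    to [Q_kernel], where [b n - 1] is the relative growth
    [M F_n(0)^2 / h n / u n] of [u]. *)
Lemma XQ n : 'X * Q n = 'X * F n + (a n * (b n - 1))%:P * F n.-1.
Proof.
rewrite {1}Q_kernel; case: n => [|m].
  by rewrite /K big_nil mulr0 subr0 mul0r mul0r addr0.
rewrite mulrBr mulrCA christoffel_darboux Q_at0.
(* Parity kills the correction along F m.+1. *)
have c0 : M * ((F m.+1).[0] / u m.+1) * ((F m).[0] / h m) = 0.
  have -> : M * ((F m.+1).[0] / u m.+1) * ((F m).[0] / h m) =
    M / u m.+1 / h m * ((F m).[0] * (F m.+1).[0]) by ring.
  by rewrite value0_eq0 mulr0.
have c1 : M * ((F m.+1).[0] / u m.+1) * ((F m.+1).[0] / h m) = a m.+1 * (b m.+1 - 1).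
  have uS : u m.+2 = u m.+1 + M * ((F m.+1).[0] / h m.+1 * (F m.+1).[0]).
    by rewrite /u KS hornerD hornerCM mulrDr addrA.
  by rewrite bE uS aE; field; rewrite !h_neq0 lt0r_neq0 ?u_gt0.
by rewrite mulrBr ![_%:P * (_%:P * _)]mulrA -!polyCM c0 c1 mul0r sub0r opprK.
Qed.

(** The second row [A2 B2], for [Q n] in terms of [F n.+1] and [F n]: the
    previous expansion with [F n.-1] eliminated by the recurrence. *)
Lemma XQ_lower n :
  'X * Q n = (1 - b n)%:P * F n.+1 + (b n)%:P * ('X * F n).
Proof.
have aF : (a n)%:P * F n.-1 = 'X * F n - F n.+1 by rewrite recurrence addrC addKr.
by rewrite XQ [a n * _]mulrC polyCM -mulrA aF !polyCB; ring.
Qed.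

(** * Expansions over the rational functions, and the ladder relations *)

Let X_neq0 : X != 0 :> {fraction {poly R}}.
Proof. by rewrite tofrac_eq0 polyX_eq0. Qed.

Let B1E n : B1 t M F n.+1 = cst (a n.+1) * (cst (b n.+1) - 1).
Proof. by rewrite /B1 cstM cstD cstN (cst_nat 1). Qed.

Let A2E n : A2 t M F n.+1 = 1 - cst (b n).
Proof. by rewrite /A2 cstD cstN (cst_nat 1). Qed.

Lemma tofrac_XQ n : X * tofrac (Q n) = A1 * tofrac (F n) + B1 t M F n * tofrac (F n.-1).
Proof. by rewrite -!tofracM XQ tofracD !tofracM. Qed.

Lemma tofrac_XQ_lower n : X * tofrac (Q n) =
  A2 t M F n.+1 * tofrac (F n.+1) + B2 t M F n.+1 * tofrac (F n).
Proof.
rewrite -!tofracM XQ_lower tofracD !tofracM; congr (_ + _).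
by rewrite mulrCA mulrA.
Qed.

Lemma tofrac_structure n : tofrac (F n.+1)^`() = 4 * cst (a n.+1) *
  ((X ^+ 2 - cst t + cst (a n.+1) + cst (a n.+2)) * tofrac (F n)
   - X * tofrac (F n.+1)).
Proof.
rewrite structure_relation tofracM tofracB !tofracM !tofracD tofracN tofracXn.
by rewrite -cst_nat -cstM.
Qed.

Lemma tofrac_structure_lower n : tofrac (F n)^`() =
  4 * (X * (X ^+ 2 - cst t + cst (a n.+1)) * tofrac (F n)
    - (X ^+ 2 - cst t + cst (a n) + cst (a n.+1)) * tofrac (F n.+1)).
Proof.
rewrite structure_relation_lower tofracM tofracB !tofracM !tofracD tofracN tofracXn.
by rewrite -cst_nat.
Qed.

Lemma tofrac_XderivQ n : X * tofrac (Q n.+1)^`() =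
  C1 t M F n.+1 * tofrac (F n.+1) + D1 t M F n.+1 * tofrac (F n).
Proof.
have deriv_XQ : tofrac (Q n.+1) + X * tofrac (Q n.+1)^`() =
    tofrac (F n.+1) + X * tofrac (F n.+1)^`() + B1 t M F n.+1 * tofrac (F n)^`().
  have := congr1 (fun p : {poly R} => tofrac p^`()) (XQ n.+1).
  by rewrite /= !derivD !derivM derivX derivC mul0r add0r !mul1r !tofracD !tofracM.
apply: (mulfI X_neq0).
have -> : X * tofrac (Q n.+1)^`() =
   tofrac (F n.+1) + X * tofrac (F n.+1)^`() + B1 t M F n.+1 * tofrac (F n)^`()
    - tofrac (Q n.+1) by rewrite -deriv_XQ addrC addKr.
rewrite mulrBr tofrac_XQ tofrac_structure tofrac_structure_lower.
rewrite B1E /A1 /C1 /D1.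
exact: deriv_coefficients.
Qed.

Lemma tofrac_XderivQ_lower n : X * tofrac (Q n)^`() =
  C2 t M F n.+1 * tofrac (F n.+1) + D2 t M F n.+1 * tofrac (F n).
Proof.
have deriv_XQ : tofrac (Q n) + X * tofrac (Q n)^`() =
    A2 t M F n.+1 * tofrac (F n.+1)^`()
    + cst (b n) * (tofrac (F n) + X * tofrac (F n)^`()).
  have := congr1 (fun p : {poly R} => tofrac p^`()) (XQ_lower n).
  by rewrite /= !derivD !derivM !derivX !derivC !mul0r !add0r !mul1r
    !tofracD !tofracM tofracD tofracM.
apply: (mulfI X_neq0).
have -> : X * tofrac (Q n)^`() = A2 t M F n.+1 * tofrac (F n.+1)^`()
    + cst (b n) * (tofrac (F n) + X * tofrac (F n)^`()) - tofrac (Q n).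
  by rewrite -deriv_XQ addrC addKr.
rewrite mulrBr tofrac_XQ_lower tofrac_structure tofrac_structure_lower.
rewrite A2E /B2 /C2 /D2.
exact: deriv_coefficients_lower.
Qed.

Lemma DeltaE n : Delta t M F n.+1 =
  A1 * B2 t M F n.+1 - B1 t M F n.+1 * A2 t M F n.+1.
Proof.
by rewrite B1E A2E /Delta /A1 /B2 -[1 - cst _]opprB mulrN opprK mulrA -expr2.
Qed.

Lemma lowering_Q n : lowering t M F n.+1 (Q n.+1) =
  det2 A1 (C1 t M F n.+1) (B1 t M F n.+1) (D1 t M F n.+1) * tofrac (Q n).
Proof.
rewrite /lowering /diffop !det2E DeltaE.
exact: (eliminate_basis X_neq0 (tofrac_XQ _) (tofrac_XQ_lower _) (tofrac_XderivQ _)).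
Qed.

Lemma raising_Q n : raising t M F n.+1 (Q n) =
  det2 (A2 t M F n.+1) (C2 t M F n.+1) (B2 t M F n.+1) (D2 t M F n.+1)
    * tofrac (Q n.+1).
Proof.
rewrite /raising /diffop !det2E DeltaE opprB [A1 * B2 _ _ _ _]mulrC.
rewrite [B1 _ _ _ _ * A2 _ _ _ _]mulrC.
exact: (eliminate_basis X_neq0 (tofrac_XQ_lower _) (tofrac_XQ _) (tofrac_XderivQ_lower _)).
Qed.

End PointMass.
End FreudPolynomials.

Theorem theorem9 (R : realType) (t M : R) (F Q : nat -> {poly R}) (n : nat)
    (t_gt0 : 0 < t) (M_gt0 : 0 < M)
    (F_orth : monic_orthogonal (ip t) F)
    (Q_orth : monic_orthogonal (ipM t M) Q)
    (n_ge1 : (1 <= n)%N) :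
  lowering t M F n (Q n) =
    det2 A1           (C1 t M F n)
         (B1 t M F n) (D1 t M F n) * tofrac (Q n.-1)
  /\
  raising t M F n (Q n.-1) =
    det2 (A2 t M F n) (C2 t M F n)
         (B2 t M F n) (D2 t M F n) * tofrac (Q n).
Proof.
case: n n_ge1 => // n _.
by split; [exact: lowering_Q|exact: raising_Q].
Qed.
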